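(* Let $G$ be a 4-connected graph. Then for every pair of longest paths $P$ and $Q$ in $G$ we have $|V(P)\cap V(Q)|\ge 4$.
   Context: All graphs are finite and simple (no loops, no parallel edges). Paths are simple (no repeated vertices or edges). The length of a path is its number of edges, and a longest path in a graph is a path of maximum length among all paths in the graph. Two paths with the same two extremes are internally disjoint if they have no internal vertices in common. A graph $G$ (with at least two vertices) is $k$-connected if, for any two distinct vertices $u$ and $v$ of $G$, there exists a set of $k$ distinct pairwise internally disjoint $u$-$v$ paths. *)

(* Defs.v *)
From mathcomp Require Import all_boot.

Set Implicit Arguments.
Unset Strict Implicit.
Unset Printing Implicit Defensive.

(* A finite simple graph is a symmetric irreflexive adjacency relation [e] on *)
(* a finite type [T] of vertices.                                             *)

Section Graph.

Variables (T : finType) (e : rel T).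

(* A path is given by the nonempty list of its vertices in order; a path and  *)
(* its reverse are thus two representations of the same subgraph, but a path  *)
(* from [u] to [v] with [u != v] has exactly one representation starting at   *)
(* [u].                                                                       *)
Definition simple_path (s : seq T) : bool :=
  if s is x :: p then path e x p && uniq (x :: p) else false.

(* number of edges *)
Definition path_length (s : seq T) : nat := (size s).-1.

Definition longest_path (s : seq T) : Prop :=
  simple_path s /\
  forall t : seq T, simple_path t -> path_length t <= path_length s.

Definition path_between (u v : T) (s : seq T) : bool :=
  [&& simple_path s, head u s == u & last u s == v].

(* all the vertices but the first and the last one *)
Definition internal_vertices (s : seq T) : seq T :=
  if s is x :: p then behead (belast x p) else [::].

Definition internally_disjoint (s t : seq T) : Prop :=
  forall w : T, ~ (w \in internal_vertices s /\ w \in internal_vertices t).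

(* The [k] paths of [F] are distinct, so the edge [uv], which has no internal *)
(* vertex, is counted at most once.                                           *)
Definition k_connected (k : nat) : Prop :=
  2 <= #|T| /\
  forall u v : T, u != v ->
    exists F : seq (seq T),
      [/\ uniq F,
          size F = k,
          {in F, forall s, path_between u v s}
        & {in F &, forall s t, s != t -> internally_disjoint s t}].

End Graph.

(* Main.v *)
Require Import Defs.
From mathcomp Require Import all_boot.

Set Implicit Arguments.
Unset Strict Implicit.
Unset Printing Implicit Defensive.

(** Suppose that the set [X] of common vertices of the longest paths [P] and [Q]
    has at most three elements. It cuts [P] and [Q] into arcs, pairwise disjoint
    and possibly empty. Let [R] be a path between vertices of two distinct arcs,
    otherwise disjoint from [P] and [Q]. Often the union of [P], [Q] and [R]
    contains two paths which, together, go through every vertex of [P] and [Q]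
    at least as often as [P] and [Q] together do, and strictly more often through
    some vertex. One of the two is then longer than [P] and [Q], so that [R]
    cannot exist ([join_refutable_false]). Such a pair of paths is looked for on
    the sketch obtained by ignoring the lengths of the arcs, which depends only
    on the two arcs and on the order in which [Q] meets [X]: the search is finite.

    With three common vertices met in the same order, the search fails for some
    pairs of arcs, such as the first and the third arc of [P]. It succeeds,
    however, whenever the positions of the two arcs on their paths have opposite
    parities, [Q] being reversed if it meets three common vertices in the order
    opposite to [P]. Call this parity the colour of an arc. As four-connectedness
    keeps the graph connected when [X] is removed ([k_connected_avoid]), a path
    [R] would join arcs of opposite colours if both colours had nonempty arcs
    ([exists_crossing]). So the arcs of one colour are all empty. But [P] and [Q]
    have at least four vertices ([k_connected_path4]), hence both have a nonempty
    arc of the other colour, and some [R] joins an arc of [P] to an arc of [Q].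
    Once the empty arcs are dropped, the search succeeds in that case too
    ([all_crossings_refutable]). *)

(** * Paths in highly connected graphs *)

Lemma sorted_rev (T : Type) (e : rel T) (s : seq T) :
  symmetric e -> sorted e (rev s) = sorted e s.
Proof.
by move=> e_sym; rewrite rev_sorted; apply: eq_sorted => x y; apply: e_sym.
Qed.

Section Paths.

Variables (T : finType) (e : rel T).

Lemma simple_pathE s :
  simple_path e s = [&& s != [::], sorted e s & uniq s].
Proof. by case: s. Qed.

Lemma longest_pathP s : longest_path e s ->
  [/\ sorted e s, uniq s
    & forall t, sorted e t -> uniq t -> size t <= size s].
Proof.
case; rewrite simple_pathE => /and3P[s0 es us] smax; split=> // t et ut.
case: t et ut => [|x t] et ut //.
have := smax (x :: t); rewrite simple_pathE et ut => /(_ isT).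
by case: s s0 {es us smax}.
Qed.

Lemma has_split (A : pred T) s : has A s ->
  exists s1 y s2, [/\ s = s1 ++ y :: s2, A y & ~~ has A s1].
Proof.
move=> hA; case: (split_find hA) => y s1 s2 Ay nA.
by exists s1, y, s2; rewrite cat_rcons.
Qed.

(** Between two disjoint sets met by a path, some stretch of the path runs from
    one set to the other and avoids both in between. *)
Lemma path_crossing (A B : pred T) x p :
    path e x p -> uniq (x :: p) -> A x -> B (last x p) ->
    (forall y, A y -> B y -> False) ->
  exists u r v, [/\ A u, B v, infix (u :: rcons r v) (x :: p)
                  & all (fun y => ~~ (A y || B y)) r].
Proof.
elim/last_ind: p x => [|p z _] x; first by move=> _ _ Ax Bx /(_ x Ax Bx).
(* [v] is the first vertex in [B], then [u] the last vertex in [A] before it. *)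
rewrite last_rcons => exp uxp Ax Bz AB.
have hB : has B (rcons p z) by rewrite has_rcons Bz.
have [p1 [v [p2 [def_p Bv nBp1]]]] := has_split hB.
have nBx : ~~ B x by apply/negP => /(AB x Ax).
have hA : has A (rev (x :: p1)) by rewrite has_rev /= Ax.
have [r1 [u [r2 [def_r Au nAr]]]] := has_split hA.
have def_p1 : x :: p1 = rev r2 ++ u :: rev r1.
  by rewrite -[LHS]revK def_r rev_cat rev_cons cat_rcons.
exists u, (rev r1), v; split=> //.
  apply/infixP; exists (rev r2), p2.
  by rewrite def_p -cat_cons def_p1 -cats1 /= -!catA.
apply/allP => y; rewrite mem_rev => yr1; rewrite negb_or (hasPn nAr _ yr1) /=.
have: y \in x :: p1 by rewrite def_p1 mem_cat inE !mem_rev yr1 !orbT.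
by rewrite inE => /predU1P[-> //|]; apply: (hasPn nBp1).
Qed.

Lemma path_between_split u v s : u != v -> path_between e u v s ->
  exists2 i, s = u :: rcons i v & internal_vertices s = i.
Proof.
move=> uv /and3P[]; case: s => [//|x p] _ /= /eqP-> /eqP.
case/lastP: p => [|i z] /=; first by move=> uvE; rewrite uvE eqxx in uv.
by rewrite last_rcons belast_rcons /= => ->; exists i.
Qed.

(** Fewer than [k] vertices do not separate a [k]-connected graph: each of them
    lies inside at most one of [k] internally disjoint paths, so one of these
    paths contains none of them. *)
Lemma k_connected_avoid k (S : {set T}) u v :
    k_connected e k -> #|S| < k -> u != v -> u \notin S -> v \notin S ->
  exists p, [/\ path e u p, last u p = v, uniq (u :: p)
              & all (fun y => y \notin S) (u :: p)].
Proof.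
move=> [_ /(_ u v)] + Sk uv uS vS => /(_ uv)[F [uF sF F_uv F_disj]].
have [/hasP[s sF' s_av]|] := boolP (has (all (fun y => y \notin S)) F).
  have := F_uv _ sF'; case/and3P.
  case: s s_av {sF'} => [//|x p] s_av /andP[exp up] /= /eqP xu /eqP pv.
  by exists p; rewrite -xu; split.
move/hasPn => hF; pose hit s := nth u s (find (mem S) s).
have hitP s : s \in F -> hit s \in S /\ hit s \in internal_vertices s.
  move=> sF'; have := hF _ sF'; rewrite -has_predC => hs.
  have hS : has (mem S) s.
    rewrite (eq_has (a2 := predC (fun y => y \notin S))) // => y /=.
    by rewrite negbK.
  have hitS : hit s \in S by apply: (nth_find u hS).
  have H : hit s \in s by rewrite mem_nth // -has_find.
  split=> //; move: (hit s) hitS H => y yS.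
  have [i -> ->] := path_between_split uv (F_uv _ sF').
  rewrite inE mem_rcons inE.
  by case/or3P => [/eqP E|/eqP E|//]; rewrite -E yS in uS vS.
have hit_inj : {in F &, injective hit}.
  move=> s t sF' tF' st; apply/eqP; case: eqP => // /eqP nst.
  have [_ h1] := hitP _ sF'; have [_ h2] := hitP _ tF'.
  by case: (F_disj _ _ sF' tF' nst (hit s)); split; rewrite // st.
have: size (map hit F) <= size (enum S).
  apply: uniq_leq_size; first by rewrite map_inj_in_uniq.
  by move=> _ /mapP[s sF' ->]; rewrite mem_enum; case: (hitP _ sF').
by rewrite size_map sF -cardE leqNgt Sk.
Qed.

Hypothesis e_sym : symmetric e.

(** Two of the paths joining [u] to [v] have internal vertices, and following
    one of them forth and the other one back visits at least four vertices. *)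
Lemma k_connected_path4 k : 3 <= k -> k_connected e k ->
  exists s, [/\ sorted e s, uniq s & 4 <= size s].
Proof.
move=> k3 [/card_gt1P[u [v [_ _ uv]]]] /(_ u v uv)[F [uF sF F_uv F_disj]].
pose G := filter (predC1 [:: u; v]) F.
have sG : 2 <= size G.
  have := count_predC (pred1 [:: u; v]) F; rewrite count_uniq_mem // sF.
  rewrite size_filter; case: (_ \in _) => /=.
    by rewrite add1n => Ek; rewrite -Ek in k3.
  by rewrite add0n => ->; apply: ltnW.
case defG: G sG => [|s [|t G']] // _.
have [uG sub] : uniq G /\ {subset [:: s; t] <= G}.
  rewrite filter_uniq // defG; split=> // y.
  by rewrite !inE => /orP[] ->; rewrite ?orbT.
have st : s != t.
  by move: uG; rewrite defG /= inE negb_or => /andP[/andP[]].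
have /andP[s2 sF'] : (s != [:: u; v]) && (s \in F).
  by have := sub s; rewrite mem_filter; apply; rewrite inE eqxx.
have /andP[t2 tF'] : (t != [:: u; v]) && (t \in F).
  by have := sub t; rewrite mem_filter; apply; rewrite !inE eqxx orbT.
have disj := F_disj _ _ sF' tF' st.
have [i def_s int_s] := path_between_split uv (F_uv _ sF').
have [j def_t int_t] := path_between_split uv (F_uv _ tF').
have /and3P[] := F_uv _ sF'; rewrite simple_pathE => /and3P[_ es us] _ _.
have /and3P[] := F_uv _ tF'; rewrite simple_pathE => /and3P[_ et ut] _ _.
exists (s ++ rev j); split.
- rewrite def_s -rcons_cons cat_rcons sorted_cat_cons rcons_cons -def_s es.
  have: sorted e (rev t) by rewrite sorted_rev //.
  by rewrite def_t rev_cons rev_rcons rcons_cons /= rcons_path => /andP[].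
- rewrite cat_uniq us rev_uniq has_rev /=; apply/andP; split.
    apply/hasPn => y yj; rewrite /= def_s inE mem_rcons inE !negb_or.
    move: ut; rewrite def_t -rcons_cons rcons_uniq /= inE negb_or.
    case/and3P=> /andP[_ vj] uj _.
    apply/and3P; split.
    - by apply: contraNneq uj => <-.
    - by apply: contraNneq vj => <-.
    - by apply/negP => yi; apply: (disj y); rewrite int_s int_t.
  by move: ut; rewrite def_t /= rcons_uniq => /and3P[].
- rewrite size_cat size_rev def_s /= size_rcons.
  move: s2 t2; rewrite def_s def_t.
  case: i {def_s int_s} => [|y i]; first by rewrite eqxx.
  by case: j {def_t int_t disj} => [|z j] /=; rewrite ?eqxx // !addnS.
Qed.

End Paths.

(** * Sketches: the search for longer paths *)

(** The union of [P], [Q] and [R] is a graph subdivided into pieces, which are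
    named by natural numbers: a piece is a node, standing for one vertex, or an
    arc, standing for the possibly empty list of vertices between two nodes or
    beyond an extreme node of a path. Numbers 0, 1, 2 name the common vertices in the order in
    which [P] meets them, and 3, 4 the ends of [R]. The arcs of [P] are 5 to 8 and
    those of [Q] are 9 to 12; 13, 14 name the second halves of the two arcs
    that [R] cuts, and 15 the interior of [R]. A word, that is a list of pieces,
    describes a path. *)
Definition is_node (i : nat) : bool := i < 5.

(** [w] can be read, forwards or backwards, inside one of the words [fs]. *)
Definition known (fs : seq (seq nat)) (w : seq nat) : bool :=
  has (fun f => infix w f || infix (rev w) f) fs.

(** Every arc of [w] is followed between the same neighbours as in [fs], so that
    [w] describes a walk in the union of the paths described by [fs]. *)
Fixpoint traversable (fs : seq (seq nat)) (w : seq nat) : bool :=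
  match w with
  | a :: ((b :: t) as w') =>
      if is_node b then known fs [:: a; b] && traversable fs w'
      else is_node a && match t with
           | c :: _ => [&& is_node c, known fs [:: a; b; c] & traversable fs t]
           | [::] => known fs [:: a; b]
           end
  | [:: a] => known fs [:: a]
  | [::] => true
  end.

Lemma traversable_cons2 fs a b t : traversable fs (a :: b :: t) =
  if is_node b then known fs [:: a; b] && traversable fs (b :: t)
  else is_node a && match t with
       | c :: _ => [&& is_node c, known fs [:: a; b; c] & traversable fs t]
       | [::] => known fs [:: a; b]
       end.
Proof. by []. Qed.

(** [w] describes a path made of pieces of [U]. *)
Definition admissible (U : seq nat) fs w :=
  [&& uniq w, all (mem U) w & traversable fs w].

(** The words [w1] and [w2] together contain each piece as often as [p] and [q]
    do, and some node more often. *)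
Definition outweigh (U p q w1 w2 : seq nat) :=
  all (fun i => (i \in p) + (i \in q) <= (i \in w1) + (i \in w2)) U &&
  has (fun i => is_node i &&
         ((i \in p) + (i \in q) < (i \in w1) + (i \in w2))) U.

(** The words that extend [x :: w] on the left by at most [n] further pieces,
    without repetition, each next piece being a neighbour of the previous one. *)
Fixpoint walks (nb : nat -> seq nat) (n : nat) (w : seq nat) (x : nat) :=
  (x :: w) ::
  if n is n'.+1 then
    flatten [seq walks nb n' (x :: w) y | y <- nb x & y \notin x :: w]
  else [::].

(** The words starting at one of [tails]. They are reversed: the starting piece
    comes last. The bound 16 is the number of names of pieces. *)
Definition tail_walks (U : seq nat) fs (tails : seq nat) :=
  let nbs := [seq [seq y <- U | known fs [:: x; y]] | x <- iota 0 16] in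
  flatten [seq walks (nth [::] nbs) (size U) [::] x | x <- tails].

(** Equal to [has], but stops at the first success even when the arguments of
    boolean operators are evaluated eagerly. *)
Definition search (A : Type) (a : pred A) (s : seq A) := find a s < size s.

(** The words [p], [q] and [r] cannot describe paths of a graph in which those
    described by [p] and [q] are longest, because two further paths outweigh
    them. Asking these two paths to start and finish with an end piece of [p] or
    [q], and to go through all nodes, only narrows the search. *)
Definition refutable (U p q r : seq nat) :=
  let fs := [:: p; q; r] in
  let tails := undup [:: head 0 p; last 0 p; head 0 q; last 0 q] in
  let nodes := filter is_node U in
  let ws := [seq w <- tail_walks U fs tails | head 0 w \in tails] in
  let ws := [seq w <- ws | all (mem w) nodes] in
  let ws := [seq w <- ws | admissible U fs w] in
  [&& uniq U, uniq p, uniq q, all (mem U) p, all (mem U) q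
    & search (fun w1 =>
        let need := [seq i <- U | (i \in w1) < (i \in p) + (i \in q)] in
        has (outweigh U p q w1) [seq w2 <- ws | all (mem w2) need])
      [seq w <- ws | last 0 w == head 0 p]].

Section Drawing.

Variables (T : eqType) (e : rel T) (pt : nat -> T) (arc : nat -> seq T).
Hypothesis e_sym : symmetric e.

(** The vertices of a piece, for an assignment [pt] of vertices to nodes and
    [arc] of lists of vertices to arcs. *)
Definition piece i := if is_node i then [:: pt i] else arc i.

(** The list of vertices described by a word. *)
Definition draw (w : seq nat) := flatten (map piece w).

Lemma piece_node i : is_node i -> piece i = [:: pt i].
Proof. by rewrite /piece => ->. Qed.

Lemma draw_cons a w : draw (a :: w) = piece a ++ draw w.
Proof. by []. Qed.

Lemma draw_cat w1 w2 : draw (w1 ++ w2) = draw w1 ++ draw w2.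
Proof. by rewrite /draw map_cat flatten_cat. Qed.

Lemma size_draw w : size (draw w) = \sum_(i <- w) size (piece i).
Proof. by rewrite size_flatten sumnE /shape -map_comp big_map. Qed.

Lemma perm_draw w1 w2 : perm_eq w1 w2 -> perm_eq (draw w1) (draw w2).
Proof. by move=> w12; apply/perm_flatten/perm_map. Qed.

Lemma mem_draw w x :
  reflect (exists2 i, i \in w & x \in piece i) (x \in draw w).
Proof.
apply: (iffP flattenP) => [[_ /mapP[i iw ->] xi]|[i iw xi]].
  by exists i.
by exists (piece i); first exact: map_f.
Qed.

Section Traversable.

Variable fs : seq (seq nat).
Hypothesis fs_sorted : all (fun f => sorted e (draw f)) fs.

Lemma known_sorted w :
  known fs w -> sorted e (draw w) || sorted e (draw (rev w)).
Proof.
have sub w' f : f \in fs -> infix w' f -> sorted e (draw w').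
  move=> /(allP fs_sorted) ef /infixP[s1 [s2 def_f]].
  by move: ef; rewrite def_f !draw_cat => /cat_sorted2[_ /cat_sorted2[]].
by case/hasP => f ff /orP[] /(sub _ _ ff) ->; rewrite ?orbT.
Qed.

(** A word does not record in which direction an arc is followed, so the vertices
    of the arc are only known up to a permutation. *)
Lemma known_end a b : is_node a -> known fs [:: a; b] ->
  exists2 s, path e (pt a) s & perm_eq s (piece b).
Proof.
move=> na /known_sorted; rewrite /draw /rev /= !cats0 (piece_node na) /=.
case/orP=> [eab | eba]; first by exists (piece b).
exists (rev (piece b)); last by rewrite perm_rev.
by move: eba; rewrite cats1 -(sorted_rev _ e_sym) rev_rcons.
Qed.

Lemma known_link a b c : is_node a -> is_node c -> known fs [:: a; b; c] ->
  exists2 s, path e (pt a) (rcons s (pt c)) & perm_eq s (piece b).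
Proof.
move=> na nc /known_sorted; rewrite /draw /rev /= !cats0.
rewrite (piece_node na) (piece_node nc) /= !cats1.
case/orP=> [eac | eca]; first by exists (piece b).
exists (rev (piece b)); last by rewrite perm_rev.
have: sorted e (rev (pt c :: rcons (piece b) (pt a))) by rewrite sorted_rev.
by rewrite rev_cons rev_rcons.
Qed.

Lemma traversable_path w a : is_node a -> traversable fs (a :: w) ->
  exists2 s, path e (pt a) s & perm_eq s (draw w).
Proof.
have [n] := ubnP (size w); elim: n w a => // n IHn [|b t] a lt_n na.
  by exists [::].
rewrite traversable_cons2; case nb: (is_node b).
  case/andP=> /(known_end na)[s1 es1].
  rewrite (piece_node nb) => /perm_small_eq s1E.
  rewrite s1E //= andbT in es1.
  move=> tbt; have [s es st] := IHn t b lt_n nb tbt.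
  exists (pt b :: s); first by rewrite /= es1.
  by rewrite draw_cons (piece_node nb) perm_cons.
rewrite na andTb; case: t lt_n => [_ /(known_end na)[s es sb]|c t lt_n].
  by exists s; rewrite // draw_cons cats0.
case/and3P=> nc /(known_link na nc)[s1 es1 s1b] tct.
have [s es st] := IHn t c (ltnW lt_n) nc tct.
exists (rcons s1 (pt c) ++ s); first by rewrite cat_path es1 last_rcons.
by rewrite !draw_cons (piece_node nc) cat_rcons perm_cat // perm_cons.
Qed.

Lemma traversable_sorted w : traversable fs w ->
  exists2 s, sorted e s & perm_eq s (draw w).
Proof.
case: w => [|a w] tw; first by exists [::].
have [na|na] := boolP (is_node a).
  have [s es sw] := traversable_path na tw; exists (pt a :: s) => //.
  by rewrite draw_cons (piece_node na) perm_cons.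
case: w tw => [/known_sorted|b w].
  by rewrite orbb; exists (draw [:: a]).
rewrite traversable_cons2; case nb: (is_node b); last by rewrite (negPf na).
case/andP=> kab /(traversable_path nb)[s es sw].
have: known fs [:: b; a].
  by move: kab; rewrite /known; under eq_has do rewrite orbC.
case/(known_end nb) => s1 es1 s1a; exists (rev s1 ++ pt b :: s).
  by rewrite sorted_cat_cons -rev_cons sorted_rev //= es1.
by rewrite !draw_cons (piece_node nb) perm_cat ?perm_cons ?perm_rev.
Qed.

End Traversable.

Lemma perm_filter_mem (U w : seq nat) : uniq U -> uniq w -> all (mem U) w ->
  perm_eq w [seq i <- U | i \in w].
Proof.
move=> uU uw /allP wU; apply: uniq_perm; rewrite ?filter_uniq // => i.
by rewrite mem_filter; case iw: (i \in w) => //=; apply/esym/wU.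
Qed.

Lemma size_draw_mem U w : uniq U -> uniq w -> all (mem U) w ->
  size (draw w) = \sum_(i <- U | i \in w) size (piece i).
Proof.
move=> uU uw wU; rewrite size_draw (perm_big _ (perm_filter_mem uU uw wU)) /=.
by rewrite big_filter.
Qed.

Lemma admissible_path U fs w :
    all (fun f => sorted e (draw f)) fs -> uniq U -> uniq (draw U) ->
    admissible U fs w ->
  exists s, [/\ sorted e s, uniq s
              & size s = \sum_(i <- U | i \in w) size (piece i)].
Proof.
move=> fs_sorted uU uD /and3P[uw wU /(traversable_sorted fs_sorted)[s es sw]].
exists s; split=> //; last by rewrite (perm_size sw) (size_draw_mem uU).
rewrite (perm_uniq sw) (perm_uniq (perm_draw (perm_filter_mem uU uw wU))).
apply: subseq_uniq uD; elim: U {uU wU} => //= i U IH.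
rewrite draw_cons; case: ifP => _; first by rewrite draw_cons cat_subseq.
exact: subseq_trans IH (suffix_subseq _ _).
Qed.

Lemma refutable_false U p q r n :
    uniq (draw U) ->
    sorted e (draw p) -> sorted e (draw q) -> sorted e (draw r) ->
    (forall s, sorted e s -> uniq s -> size s <= n) ->
    n <= size (draw p) -> n <= size (draw q) ->
  ~~ refutable U p q r.
Proof.
move=> uD ep eq er max_n np nq; apply/negP => /and3P[uU up /and4P[uq pU qU]].
rewrite /search -has_find => /hasP[w1].
rewrite 2!mem_filter => /and3P[_ adm1 _].
case/hasP=> w2; rewrite 2!mem_filter => /and3P[_ adm2 _] /andP[].
move=> /allP w_ge /hasP[i iU /andP[ni w_gt]].
have fs_sorted : all (fun f => sorted e (draw f)) [:: p; q; r].
  by rewrite /= ep eq er.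
have [s1 [es1 us1 size1]] := admissible_path fs_sorted uU uD adm1.
have [s2 [es2 us2 size2]] := admissible_path fs_sorted uU uD adm2.
have: size (draw p) + size (draw q) < size s1 + size s2.
  pose mass (w w' : seq nat) j := ((j \in w) + (j \in w')) * size (piece j).
  have massE w w' : \sum_(j <- U | j \in w) size (piece j)
      + \sum_(j <- U | j \in w') size (piece j) = \sum_(j <- U) mass w w' j.
    rewrite [X in X + _]big_mkcond [X in _ + X]big_mkcond -big_split /=.
    apply: eq_bigr => j _; rewrite /mass mulnDl.
    by do 2!case: (_ \in _); rewrite ?mul1n.
  rewrite size1 size2 (size_draw_mem uU up pU) (size_draw_mem uU uq qU) !massE.
  rewrite !(bigD1_seq i) //= -addSn leq_add //.
    by rewrite /mass (piece_node ni) /= !muln1.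
  rewrite !(big_seq_cond (fun j => j != i)); apply: leq_sum => j.
  by case/andP=> /w_ge ge_j _; rewrite leq_mul2r ge_j orbT.
apply/negP; rewrite -leqNgt; apply: leq_trans (leq_add np nq).
by rewrite leq_add // max_n.
Qed.

End Drawing.

(** Cut the arc [a] of [w] at a new node [v]; its second half is named [a']. *)
Definition cut (a v a' : nat) (w : seq nat) : seq nat :=
  flatten [seq if i == a then [:: a; v; a'] else [:: i] | i <- w].

(** The search, for a path [R] between a vertex of [a] and a vertex of [b]. *)
Definition join_refutable (U p q : seq nat) (a b : nat) :=
  let c w := cut b 4 14 (cut a 3 13 w) in
  refutable (rcons (c U) 15) (c p) (c q) [:: 3; 15; 4].

(** The nodes [vs] alternating with arcs numbered from [k] on. *)
Fixpoint weave (k : nat) (vs : seq nat) : seq nat :=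
  if vs is i :: vs' then k :: i :: weave k.+1 vs' else [:: k].

(** The parity of the position of an arc on its path; for the arcs of [Q], which
    are those numbered beyond 8, [flip] exchanges the parities, as reversing a path
    with four arcs does. *)
Definition colour (flip : bool) (i : nat) : bool := odd i (+) (flip && (8 < i)).

(** The word [w] without the arcs whose colour is not [c]. *)
Definition monochrome (flip c : bool) (w : seq nat) :=
  [seq i <- w | is_node i || (colour flip i == c)].

(** When [Q] meets the common vertices in the order [vs], neither a path joining
    arcs of opposite colours, nor one joining an arc of [P] to an arc of [Q] of
    the same colour when the arcs of the other colour are empty, can exist. *)
Definition crossings_refutable (vs : seq nat) : bool :=
  let m := size vs in
  let flip := vs == [:: 2; 1; 0] in
  let pa := iota 5 m.+1 in
  let qa := iota 9 m.+1 in
  let U := iota 0 m ++ pa ++ qa in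
  let p := weave 5 (iota 0 m) in
  let q := weave 9 vs in
  [&& all (fun a => all (join_refutable U p q a)
                        [seq b <- pa ++ qa | ~~ colour flip b])
          [seq a <- pa ++ qa | colour flip a]
    & all (fun c =>
        all (fun a => all (join_refutable U (monochrome flip c p)
                                            (monochrome flip c q) a)
                          [seq b <- qa | colour flip b == c])
            [seq a <- pa | colour flip a == c]) [:: true; false]].

Lemma all_crossings_refutable :
  all (fun m => all crossings_refutable (permutations (iota 0 m))) (iota 0 4).
Proof. by vm_compute. Qed.

Lemma perm_weave k vs : perm_eq (weave k vs) (vs ++ iota k (size vs).+1).
Proof.
elim: vs k => // i vs IH k; apply/permP => A /=.
by rewrite (permP (IH k.+1)) !count_cat /= (addnCA (A k)) (addnCA (A k)).
Qed.

Section Drawings.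

Variables (T : eqType).
Implicit Types (pt : nat -> T) (arc : nat -> seq T) (w : seq nat).

Lemma eq_draw pt pt' arc arc' w :
    (forall i, i \in w -> is_node i -> pt i = pt' i) ->
    (forall i, i \in w -> ~~ is_node i -> arc i = arc' i) ->
  draw pt arc w = draw pt' arc' w.
Proof.
move=> eq_pt eq_arc; congr flatten; apply/eq_in_map => i iw; rewrite /piece.
by case: ifPn => ni; rewrite (eq_pt, eq_arc).
Qed.

Lemma draw_filter pt arc (keep : pred nat) w :
    (forall i, i \in w -> ~~ keep i -> piece pt arc i = [::]) ->
  draw pt arc (filter keep w) = draw pt arc w.
Proof.
elim: w => //= i w IH piece0; rewrite draw_cons -IH => [|j jw]; last first.
  by apply: piece0; rewrite inE jw orbT.
by case: ifPn => [|/piece0->] //; rewrite inE eqxx.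
Qed.

Lemma draw_cut pt arc a v a' w s1 x s2 :
    ~~ is_node a -> is_node v -> ~~ is_node a' -> a' != a ->
    v \notin w -> a' \notin w -> arc a = s1 ++ x :: s2 ->
  draw [eta pt with v |-> x] [eta arc with a |-> s1, a' |-> s2] (cut a v a' w)
    = draw pt arc w.
Proof.
move=> na nv na' a'a vw a'w def_a; rewrite /cut.
elim: w vw a'w => //= i w IH; rewrite !inE !negb_or.
move=> /andP[vi vw] /andP[a'i a'w].
rewrite draw_cat draw_cons IH //; congr (_ ++ _).
case: ifPn => [/eqP->|ia]; rewrite !draw_cons cats0 /piece /=.
  by rewrite (negPf na) nv (negPf na') /= !eqxx (negPf a'a) def_a.
by rewrite (eq_sym i v) (negPf vi) (negPf ia) (eq_sym i a') (negPf a'i).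
Qed.

(** Any list is drawn by the alternating word whose nodes are its elements that
    satisfy [A]. *)
Lemma draw_weave pt (A : pred T) s k vs :
    4 < k -> all is_node vs -> map pt vs = filter A s ->
  exists arc, draw pt arc (weave k vs) = s /\ forall i, ~~ has A (arc i).
Proof.
elim: s k vs => [|y s IH] k vs k5 ns /=.
  case: vs ns => // _ _; exists (fun=> [::]).
  by rewrite /draw /= /piece /is_node ltnNge k5.
have nk : is_node k = false by rewrite /is_node ltnNge k5.
have tail vs' arc s' : all is_node vs' ->
    draw pt [eta arc with k |-> s'] (weave k.+1 vs')
      = draw pt arc (weave k.+1 vs').
  move=> ns'; apply: eq_draw => // i.
  rewrite (perm_mem (perm_weave _ _)) mem_cat mem_iota.
  case/orP=> [/(allP ns')-> //|/andP[ki _] _ /=].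
  by rewrite gtn_eqF.
case: ifPn => Ay.
  case: vs ns => // i vs /= /andP[ni ns] [def_y def_is].
  have [arc [<- nA]] := IH k.+1 vs (ltnW k5) ns def_is.
  exists [eta arc with k |-> [::]]; rewrite !draw_cons tail //.
  by rewrite /piece nk ni /= eqxx def_y; split=> // j; case: eqP.
move=> def_is; have [arc [<- nA]] := IH k vs k5 ns def_is.
exists [eta arc with k |-> y :: arc k]; split; last first.
  by move=> j /=; case: eqP => //= _; rewrite negb_or Ay nA.
case: vs ns {def_is} => [|i vs] /= => [_|/andP[ni ns]].
  by rewrite /draw /= /piece nk /= eqxx.
by rewrite !draw_cons tail // /piece nk ni /= eqxx.
Qed.

End Drawings.

(** Soundness of the search: cutting the arcs [a] and [b] at the ends [x] and [y]
    of a path with interior [r] gives a drawing of the cut words. *)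
Lemma join_refutable_false (T : eqType) (e : rel T) pt arc U p q n a b x y r :
    symmetric e ->
    (forall s, sorted e s -> uniq s -> size s <= n) ->
    uniq (draw pt arc U) ->
    all (fun i => i \notin [:: 3; 4; 13; 14; 15]) (U ++ p ++ q) ->
    sorted e (draw pt arc p) -> n <= size (draw pt arc p) ->
    sorted e (draw pt arc q) -> n <= size (draw pt arc q) ->
    ~~ is_node a -> ~~ is_node b -> a != b -> a \in U -> b \in U ->
    x \in arc a -> y \in arc b ->
    path e x (rcons r y) -> uniq r -> ~~ has (mem (draw pt arc U)) r ->
  ~~ join_refutable U p q a b.
Proof.
move=> e_sym max_n uU fresh ep np eq nq na nb ab aU bU xa yb er ur rU.
have freshE w i :
    w \in [:: U; p; q] -> i \in [:: 3; 4; 13; 14; 15] -> i \notin w.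
  move=> ww; apply: contraL => iw; apply: (allP fresh).
  by move: ww iw; rewrite !mem_cat !inE => /or3P[]/eqP-> ->; rewrite ?orbT.
have [s1 [s2 def_a]] : exists s1 s2, arc a = s1 ++ x :: s2.
  by case/splitPr: xa => s1 s2; exists s1, s2.
have [t1 [t2 def_b]] : exists t1 t2, arc b = t1 ++ y :: t2.
  by case/splitPr: yb => t1 t2; exists t1, t2.
have a_old i : i \in [:: 3; 4; 13; 14; 15] -> i != a.
  by move=> iI; apply: contraNneq (freshE U i (mem_head _ _) iI) => ->.
have b_old i : i \in [:: 3; 4; 13; 14; 15] -> i != b.
  by move=> iI; apply: contraNneq (freshE U i (mem_head _ _) iI) => ->.
pose pt1 := [eta pt with 3 |-> x].
pose arc1 := [eta arc with a |-> s1, 13 |-> s2].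
pose pt2 := [eta pt1 with 4 |-> y].
pose arc2 := [eta arc1 with b |-> t1, 14 |-> t2].
pose arc3 := [eta arc2 with 15 |-> r].
pose c w := cut b 4 14 (cut a 3 13 w).
have mem_cut i j v j' w :
    i \in cut j v j' w -> [|| i \in w, i == v | i == j'].
  case/flattenP => _ /mapP[k kw ->]; case: eqP => [kj|_]; rewrite !inE.
    by case/or3P => /eqP->; rewrite ?eqxx ?orbT // -kj kw.
  by move/eqP->; rewrite kw.
have draw_c w : w \in [:: U; p; q] -> draw pt2 arc3 (c w) = draw pt arc w.
  move=> ww; have w3 := freshE w _ ww.
  rewrite -(@draw_cut _ pt arc a 3 13 w s1 x s2 na isT isT
              (a_old 13 isT) (w3 3 isT) (w3 13 isT) def_a) //.
  rewrite -/pt1 -/arc1.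
  have cut_new i : i \in [:: 4; 14; 15] -> i \notin cut a 3 13 w.
    move=> iI; apply/negP => /mem_cut; apply/negP; move: iI.
    by rewrite !inE => /or3P[]/eqP->; rewrite orbF w3.
  have arc1b : arc1 b = t1 ++ y :: t2.
    by rewrite /arc1 /= (eq_sym b a) (negPf ab) eq_sym (negPf (b_old 13 isT)).
  rewrite -(@draw_cut _ pt1 arc1 b 4 14 _ t1 y t2 nb isT isT (b_old 14 isT)
              (cut_new 4 isT) (cut_new 14 isT) arc1b).
  apply: eq_draw => // i /mem_cut ic _ /=; case: eqP => // i15.
  by move: ic; rewrite i15 (negPf (cut_new 15 isT)).
have x3 : piece pt2 arc3 3 = [:: x] by [].
have y4 : piece pt2 arc3 4 = [:: y] by [].
have r15 : piece pt2 arc3 15 = r by [].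
rewrite /join_refutable -/(c U) -/(c p) -/(c q).
apply: (@refutable_false _ e pt2 arc3 e_sym _ _ _ _ n) => //;
  rewrite ?draw_c ?inE ?eqxx ?orbT //.
  rewrite -cats1 draw_cat draw_c ?inE ?eqxx // draw_cons cats0 r15.
  by rewrite cat_uniq uU rU.
by rewrite !draw_cons x3 y4 r15 /= cats1.
Qed.

(** * Longest paths meet in four vertices *)

(** Fewer than [k] vertices [xs] do not separate the arcs [ps] from the arcs [qs],
    unless all arcs on one side are empty. *)
Lemma exists_crossing (T : finType) (e : rel T) k pt arc (xs : seq T) ps qs :
    k_connected e k -> size xs < k ->
    all (predC is_node) (ps ++ qs) ->
    uniq (xs ++ draw pt arc (ps ++ qs)) ->
    draw pt arc ps != [::] -> draw pt arc qs != [::] ->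
  exists a b x y r, [/\ a \in ps, b \in qs, x \in arc a & y \in arc b] /\
    [/\ path e x (rcons r y), uniq r
      & ~~ has (mem (xs ++ draw pt arc (ps ++ qs))) r].
Proof.
move=> kG ltk arcs; rewrite draw_cat cat_uniq => /and3P[_ disjX uD] nps nqs.
have in_arc ds x : {subset ds <= ps ++ qs} -> x \in draw pt arc ds ->
    exists2 a, a \in ds & x \in arc a.
  move=> sub /mem_draw[a ad]; rewrite /piece (negPf (allP arcs a (sub a ad))).
  by exists a.
case Eu: (draw pt arc ps) nps => [|u us] // _.
case Ev: (draw pt arc qs) nqs => [|v vs] // _.
have uP : u \in draw pt arc ps by rewrite Eu inE eqxx.
have vQ : v \in draw pt arc qs by rewrite Ev inE eqxx.
rewrite -Eu -Ev => {us vs Eu Ev}.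
have disj y : y \in draw pt arc ps -> y \in draw pt arc qs -> False.
  by move=> yP yQ; move: uD; rewrite cat_uniq => /and3P[_ /hasPn/(_ _ yQ)/negP].
have notX y : y \in draw pt arc ps ++ draw pt arc qs -> y \notin [set x in xs].
  by move=> /(hasPn disjX); rewrite inE.
have [||||s [es sv us avoid]] :=
  k_connected_avoid (S := [set x in xs]) (u := u) (v := v) kG.
- by apply: leq_ltn_trans ltk; rewrite cardsE card_size.
- by apply/eqP => uv; apply: (disj u); rewrite // uv.
- by rewrite notX // mem_cat uP.
- by rewrite notX // mem_cat vQ orbT.
have [|y [r [z [yP zQ /infixP[s1 [s2 def_s]] rPQ]]]] :=
  path_crossing (A := mem (draw pt arc ps)) (B := mem (draw pt arc qs))
    es us uP _ disj.
  by rewrite sv.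
have [a aps ya] := in_arc ps y (mem_subseq (prefix_subseq _ _)) yP.
have [b bqs zb] := in_arc qs z (mem_subseq (suffix_subseq _ _)) zQ.
exists a, b, y, z, r; split; split=> //.
- have: sorted e (u :: s) by [].
  by rewrite def_s => /cat_sorted2[_ /cat_sorted2[]].
- move: us; rewrite def_s cat_uniq => /and3P[_ _].
  by rewrite cat_uniq /= rcons_uniq => /andP[/and3P[]].
- apply/hasPn => w wr; rewrite /= !mem_cat negb_or (allP rPQ) // andbT.
  have /(allP avoid): w \in u :: s.
    by rewrite def_s !(mem_cat, inE, mem_rcons) wr !orbT.
  by rewrite inE.
Qed.

Theorem theorem4p2 (T : finType) (e : rel T)
  (e_sym : symmetric e) (e_irrefl : irreflexive e)
  (e_conn : k_connected e 4)
  (P Q : seq T) (hP : longest_path e P) (hQ : longest_path e Q) :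
  4 <= #|[set x in P] :&: [set x in Q]|.
Proof.
have [eP uP maxP] := longest_pathP hP.
have [eQ uQ maxQ] := longest_pathP hQ.
have sPQ : size Q = size P by apply/eqP; rewrite eqn_leq maxP // maxQ.
have P4 : 4 <= size P.
  have [s [es us s4]] := k_connected_path4 e_sym (isT : 3 <= 4) e_conn.
  exact: leq_trans s4 (maxP s es us).
rewrite leqNgt; apply/negP => ltX.
pose xs := filter (mem Q) P; pose m := size xs.
have m4 : m < 4.
  have uxs : uniq xs by rewrite filter_uniq.
  rewrite /m -(card_uniqP uxs); apply: leq_ltn_trans ltX.
  by apply/subset_leq_card/subsetP => x; rewrite mem_filter !inE andbC.
have [x0 _] : exists x0, x0 \in P.
  have: 0 < size P by apply: leq_trans P4.
  by rewrite -has_predT => /hasP[x]; exists x.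
pose pt := nth x0 xs.
(* The order in which [Q] meets the common vertices. *)
have [vs vs_perm def_vs] :
    exists2 vs, perm_eq vs (iota 0 m) & filter (mem P) Q = map pt vs.
  apply/(perm_iotaP x0)/uniq_perm; rewrite ?filter_uniq // => x.
  by rewrite !mem_filter andbC.
have size_vs : size vs = m by rewrite (perm_size vs_perm) size_iota.
have vs_lt i : i \in vs -> i < m by rewrite (perm_mem vs_perm) mem_iota.
have vs_node : all is_node vs.
  by apply/allP => i /vs_lt/ltn_trans; apply; apply: ltn_trans m4 _.
have io_node : all is_node (iota 0 m) by rewrite -(perm_all _ vs_perm).
have def_xs : map pt (iota 0 m) = xs by rewrite map_nth_iota0 // take_size.
have [arcP [drawP _]] :=
  draw_weave (A := mem Q) (s := P) (k := 5) isT io_node def_xs.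
have [arcQ [drawQ arcQ_P]] :=
  draw_weave (A := mem P) (s := Q) (k := 9) isT vs_node (esym def_vs).
pose arc i := if i < 9 then arcP i else arcQ i.
set p := weave 5 (iota 0 m) in drawP.
set q := weave 9 vs in drawQ.
pose pa := iota 5 m.+1; pose qa := iota 9 m.+1.
have p_perm : perm_eq p (iota 0 m ++ pa).
  by have := perm_weave 5 (iota 0 m); rewrite size_iota.
have q_perm : perm_eq q (iota 0 m ++ qa).
  by apply: perm_trans (perm_weave _ _) _; rewrite size_vs perm_cat2r.
have pa_lt i : i \in pa -> i < 9.
  by rewrite mem_iota => /andP[_ /leq_trans]; apply; rewrite addnS ltn_add2l.
have qa_ge i : i \in qa -> 9 <= i by rewrite mem_iota => /andP[].
have {}drawP : draw pt arc p = P.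
  rewrite -drawP; apply: eq_draw => // i; rewrite (perm_mem p_perm) mem_cat.
  by case/orP => [/(allP io_node)->//|/pa_lt i9 _]; rewrite /arc i9.
have {}drawQ : draw pt arc q = Q.
  rewrite -drawQ; apply: eq_draw => // i; rewrite (perm_mem q_perm) mem_cat.
  by case/orP => [/(allP io_node)->//|/qa_ge i9 _]; rewrite /arc ltnNge i9.
have draw_xs : draw pt arc (iota 0 m) = xs.
  rewrite -def_xs /draw; elim: (iota 0 m) io_node => //= i s IH /andP[ni /IH->].
  by rewrite piece_node.
pose U := iota 0 m ++ pa ++ qa.
have drawU : draw pt arc U = xs ++ draw pt arc (pa ++ qa).
  by rewrite -draw_xs -draw_cat.
have permP : perm_eq P (xs ++ draw pt arc pa).
  by rewrite -draw_xs -draw_cat -{1}drawP perm_draw.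
have permQ : perm_eq Q (xs ++ draw pt arc qa).
  by rewrite -draw_xs -draw_cat -{1}drawQ perm_draw.
have uU : uniq (draw pt arc U).
  rewrite /U catA draw_cat draw_cat draw_xs cat_uniq -(perm_uniq permP) uP /=.
  have := uQ; rewrite (perm_uniq permQ) cat_uniq => /and3P[_ _ ->].
  rewrite andbT.
  apply/hasPn => x /mem_draw[i iq xi]; rewrite /= -(perm_mem permP).
  apply: contra (arcQ_P i) => xP; apply/hasP; exists x => //.
  have i9 := qa_ge i iq.
  have i5 : i < 5 = false by apply/leq_gtF/(leq_trans _ i9).
  by move: xi; rewrite /piece /is_node /arc i5 (leq_gtF i9).
have fresh : all (fun i => i \notin [:: 3; 4; 13; 14; 15]) (U ++ p ++ q).
  have UI : all (fun i => i \notin [:: 3; 4; 13; 14; 15]) U.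
    by rewrite /U /pa /qa; move: (m) m4; do 4!case=> //.
  move: (UI); rewrite /U !all_cat (perm_all _ p_perm) (perm_all _ q_perm).
  rewrite !all_cat.
  by case/and3P=> -> -> ->.
have arcs : all (predC is_node) (pa ++ qa).
  apply/allP => i; rewrite mem_cat /= /is_node -leqNgt.
  case/orP=> [|/qa_ge]; last exact: leq_trans.
  by rewrite mem_iota => /andP[].
have pa_n0 : draw pt arc pa != [::].
  rewrite -size_eq0 -lt0n -(ltn_add2l (size xs)) addn0 -size_cat.
  rewrite -(perm_size permP).
  exact: leq_trans m4 P4.
have qa_n0 : draw pt arc qa != [::].
  rewrite -size_eq0 -lt0n -(ltn_add2l (size xs)) addn0 -size_cat.
  rewrite -(perm_size permQ) sPQ.
  exact: leq_trans m4 P4.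
have /andP[check1 check2] : crossings_refutable vs.
  have /allP/(_ m) := all_crossings_refutable.
  rewrite mem_iota m4 => /(_ isT)/allP.
  by apply; rewrite mem_permutations.
rewrite size_vs in check1 check2.
set flip := vs == _ in check1 check2.
(* A path with interior [r] joining an arc of [P] or [Q] to another one cannot
   exist if the search succeeds. The words [p'] and [q'] are [p] and [q], or
   what remains of them when empty arcs are dropped. *)
have no_crossing p' q' a b : draw pt arc p' = P -> draw pt arc q' = Q ->
    {subset p' <= p} -> {subset q' <= q} ->
    a \in pa ++ qa -> b \in pa ++ qa -> a != b -> join_refutable U p' q' a b ->
    forall x y r, x \in arc a -> y \in arc b ->
      path e x (rcons r y) -> uniq r -> ~~ has (mem (draw pt arc U)) r -> False.
  move=> dp' dq' p'p q'q aA bA ab ref x y r xa yb exy ur rU.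
  have arcU i : i \in pa ++ qa -> i \in U.
    by move=> iA; rewrite /U mem_cat iA orbT.
  have fresh' : all (fun i => i \notin [:: 3; 4; 13; 14; 15]) (U ++ p' ++ q').
    apply/allP => i; rewrite (mem_cat i U) (mem_cat i p') => iw.
    apply: (allP fresh); rewrite (mem_cat i U) (mem_cat i p).
    by case/or3P: iw => [-> | /p'p-> | /q'q->]; rewrite ?orbT.
  move: ref; apply/negP.
  apply: (join_refutable_false e_sym maxP uU fresh' _ _ _ _ (allP arcs a aA)
            (allP arcs b bA) ab (arcU a aA) (arcU b bA) xa yb exy ur rU).
  1-4: by rewrite ?dp' ?dq' ?sPQ.
(* Not all nonempty arcs have the same colour: dropping the others does not change
   [P] and [Q], and some path joins an arc of [P] to an arc of [Q]. *)
have one_colour c :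
    (forall i, i \in pa ++ qa -> colour flip i != c -> arc i = [::]) -> False.
  move=> empty.
  have uU' : uniq (xs ++ draw pt arc (pa ++ qa)) by rewrite -drawU.
  have [a [b [x [y [r [[apa bqa xa yb] [exy ur rU]]]]]]] :=
    exists_crossing e_conn (m4 : size xs < 4) arcs uU' pa_n0 qa_n0.
  have aA : a \in pa ++ qa by rewrite mem_cat apa.
  have bA : b \in pa ++ qa by rewrite mem_cat bqa orbT.
  have col_a : colour flip a == c.
    by apply: contraTT xa => /(empty a aA)->.
  have col_b : colour flip b == c.
    by apply: contraTT yb => /(empty b bA)->.
  have keepE w : {subset w <= U} ->
      draw pt arc (monochrome flip c w) = draw pt arc w.
    move=> wU; apply: draw_filter => i /wU; rewrite /piece negb_or.
    rewrite mem_cat => /orP[/(allP io_node)->//|iA] /andP[/negPf-> /=].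
    exact: empty.
  have pU : {subset p <= U}.
    by move=> i; rewrite (perm_mem p_perm) /U !mem_cat => /orP[]->; rewrite ?orbT.
  have qU : {subset q <= U}.
    by move=> i; rewrite (perm_mem q_perm) /U !mem_cat => /orP[]->; rewrite ?orbT.
  apply: (no_crossing (monochrome flip c p) (monochrome flip c q) a b
            _ _ _ _ aA bA _ _ x y r) => //.
  - by rewrite keepE.
  - by rewrite keepE.
  - exact/mem_subseq/filter_subseq.
  - exact/mem_subseq/filter_subseq.
  - by rewrite neq_ltn (leq_trans (pa_lt a apa) (qa_ge b bqa)).
  - have c_in : c \in [:: true; false] by case: (c).
    have /allP/(_ a) := allP check2 c c_in.
    rewrite mem_filter col_a apa => /(_ isT)/allP.
    by apply; rewrite mem_filter col_b.
  - by rewrite drawU.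
pose ps := [seq a <- pa ++ qa | colour flip a].
pose qs := [seq b <- pa ++ qa | ~~ colour flip b].
have perm_pq : perm_eq (ps ++ qs) (pa ++ qa) by apply/permPl/perm_filterC.
have draw_nil ds i :
    draw pt arc ds = [::] -> i \in ds -> i \in pa ++ qa -> arc i = [::].
  move=> ds0 id iA; case def_i: (arc i) => [//|x s].
  have: x \in draw pt arc ds.
    apply/mem_draw; exists i; rewrite // /piece (negPf (allP arcs i iA)) def_i.
    exact: mem_head.
  by rewrite ds0.
have [ps0|ps_n0] := eqVneq (draw pt arc ps) [::].
  apply: (one_colour false) => i iA ci; apply: (draw_nil ps) => //.
  by rewrite mem_filter iA andbT; move: ci; case: colour.
have [qs0|qs_n0] := eqVneq (draw pt arc qs) [::].
  apply: (one_colour true) => i iA ci; apply: (draw_nil qs) => //.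
  by rewrite mem_filter iA andbT; move: ci; case: colour.
have arcs' : all (predC is_node) (ps ++ qs) by rewrite (perm_all _ perm_pq).
have permU : perm_eq (xs ++ draw pt arc (ps ++ qs)) (draw pt arc U).
  by rewrite drawU perm_cat2l perm_draw.
have uU' : uniq (xs ++ draw pt arc (ps ++ qs)) by rewrite (perm_uniq permU).
have [a [b [x [y [r [[aps bqs xa yb] [exy ur rU]]]]]]] :=
  exists_crossing e_conn (m4 : size xs < 4) arcs' uU' ps_n0 qs_n0.
move: (aps) (bqs); rewrite !mem_filter => /andP[ca aA] /andP[cb bA].
apply: (no_crossing p q a b _ _ _ _ aA bA _ _ x y r) => //.
- by apply: contraNneq cb => <-.
- exact: allP (allP check1 a aps) b bqs.
- by rewrite -(eq_has (perm_mem permU)).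
Qed.
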